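(* Consider Algorithm 7 (described in the context) modified so that the query noise is $\nu_i=\mathrm{Lap}(c\Delta/\epsilon_2)$ instead of $\mathrm{Lap}(2c\Delta/\epsilon_2)$. If the query sequence is monotonic, then for all $\epsilon_1>0,\epsilon_2>0,\epsilon_3\ge0$, $\Delta>0$, integer $c\ge1$ and thresholds, this modified algorithm satisfies $(\epsilon_1+\epsilon_2+\epsilon_3)$-differential privacy: for all neighboring $D\simeq D'$ and every measurable set $S$ of outputs, $\Pr[\mathcal{A}(D)\in S]\le e^{\epsilon_1+\epsilon_2+\epsilon_3}\Pr[\mathcal{A}(D')\in S]$.
   Context: Two datasets are neighboring ($D\simeq D'$) if they differ in one tuple. A query $q$ has sensitivity at most $\Delta$ if $|q(D)-q(D')|\le\Delta$ for all $D\simeq D'$. A finite sequence of queries $q_1,\dots,q_n$ (each of sensitivity at most $\Delta$) is monotonic if for every pair of neighboring datasets $D\simeq D'$, either $q_i(D)\ge q_i(D')$ for all $i$, or $q_i(D)\le q_i(D')$ for all $i$. $\mathrm{Lap}(\beta)$ denotes a random variable with density $\frac{1}{2\beta}e^{-|x|/\beta}$; all noise variables are independent. Algorithm 7 (standard SVT): Input: dataset $D$, queries $q_1,q_2,\dots$, thresholds $T_1,T_2,\dots$, cutoff $c$, parameters $\epsilon_1,\epsilon_2,\epsilon_3$. Sample $\rho=\mathrm{Lap}(\Delta/\epsilon_1)$ once, set count $=0$. For each query $q_i$: sample $\nu_i=\mathrm{Lap}(2c\Delta/\epsilon_2)$; if $q_i(D)+\nu_i\ge T_i+\rho$, then output $a_i=q_i(D)+\mathrm{Lap}(c\Delta/\epsilon_3)$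 (fresh noise) if $\epsilon_3>0$, or $a_i=\top$ if $\epsilon_3=0$; increment count and abort if count $\ge c$. Otherwise output $a_i=\bot$. *)

(* Defs.v *)
From HB Require Import structures.
From mathcomp Require Import all_boot all_order all_algebra.
From mathcomp Require Import all_classical all_reals all_analysis.
Set Implicit Arguments. Unset Strict Implicit. Unset Printing Implicit Defensive.
Import Order.TTheory GRing.Theory Num.Theory.
Local Open Scope classical_set_scope.
Local Open Scope ring_scope.

Section SVT.
Variable R : realType.

Definition laplace_pdf (b x : R) : R := (2 * b)^-1 * expR (- (`|x| / b)).

Variables (d : measure_display) (Omega : measurableType d).

Definition laplace_rv (P : probability Omega R) (X : Omega -> R) (b : R) : Prop :=
  measurable_fun [set: Omega] X /\
  forall B : set R, measurable B ->
    P (X @^-1` B) = (\int[lebesgue_measure]_(x in B) (laplace_pdf b x)%:E)%E.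

Definition mutually_independent (I : finType) (P : probability Omega R)
    (X : I -> Omega -> R) : Prop :=
  forall (J : {set I}) (B : I -> set R), (forall i, measurable (B i)) ->
    P (\bigcap_(i in [set i | i \in J]) (X i @^-1` B i)) =
    (\prod_(i in J) P (X i @^-1` B i))%E.

Definition svt_noise (n : nat) (rho : Omega -> R) (nu eta : 'I_n -> Omega -> R)
    : option ('I_n + 'I_n) -> Omega -> R :=
  fun k => match k with
           | None => rho
           | Some (inl i) => nu i
           | Some (inr i) => eta i
           end.
End SVT.

(** Encoding of one output symbol a_i as a pair (tag, value) in nat * R:
      (0, 0)  = bottom,
      (1, 0)  = top            (case eps3 = 0),
      (2, v)  = numeric answer v (case eps3 > 0),
      (3, 0)  = no output (the algorithm has aborted before query i). *)
Section Alg.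
Variable R : realType.

Fixpoint svt_loop (c : nat) (eps3 rho : R) (cnt : nat)
    (xs : seq (R * R * R * R)) : seq (nat * R) :=
  match xs with
  | [::] => [::]
  | (qv, t, nu, eta) :: xs' =>
      if (c <= cnt)%N then (3%N, 0) :: svt_loop c eps3 rho cnt xs'
      else if t + rho <= qv + nu then
        (if 0 < eps3 then (2%N, qv + eta) else (1%N, 0))
          :: svt_loop c eps3 rho cnt.+1 xs'
      else (0%N, 0) :: svt_loop c eps3 rho cnt xs'
  end.

Definition svt_out (Dat : Type) (n : nat) (q : 'I_n -> Dat -> R) (T : 'I_n -> R)
    (c : nat) (eps3 : R) (D : Dat) (rho : R) (nu eta : 'I_n -> R)
    : n.-tuple (nat * R) :=
  let out := svt_loop c eps3 rho 0
               [seq (q i D, T i, nu i, eta i) | i <- enum 'I_n] in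
  [tuple nth (3%N, 0) out i | i < n].

Definition sensitivity_le (Dat : Type) (nbr : Dat -> Dat -> Prop) (n : nat)
    (q : 'I_n -> Dat -> R) (Delta : R) : Prop :=
  forall i D D', nbr D D' -> `|q i D - q i D'| <= Delta.

Definition monotonic_queries (Dat : Type) (nbr : Dat -> Dat -> Prop) (n : nat)
    (q : 'I_n -> Dat -> R) : Prop :=
  forall D D', nbr D D' ->
    (forall i, q i D' <= q i D) \/ (forall i, q i D <= q i D').
End Alg.

(* Main.v *)
(** Gather all noises into one vector. Translating an independent family of
    Laplace variables by a fixed vector [s] changes the probability of any event
    by a factor of at most [expR (\sum_k `|s k| / b k)]. Split the set [S] of
    outputs according to the set [A] of queries answered positively, so that
    [#|A| <= c]. Any noise for which [D] yields an output of pattern [A] is sent,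
    by a translation depending on [A] only, to a noise for which [D'] yields the
    same output: add [r] to [rho], where [r = 0] if all queries decrease from [D]
    to [D'] and [r = Delta] otherwise, and for [i] in [A] add
    [r + q i D - q i D'] to [nu i] and [q i D - q i D'] to [eta i]. Monotonicity
    puts [r + q i D - q i D'] in [[0, Delta]]; being nonnegative, it leaves the
    negative answers negative without moving their noise, and being at most
    [Delta], it saves the usual factor 2 in the query noise. The translation
    costs at most [eps1 + c * (eps2 / c) + c * (eps3 / c)]. *)

Require Import Defs.
From HB Require Import structures.
From mathcomp Require Import all_boot all_order all_algebra.
From mathcomp Require Import all_classical all_reals all_analysis.
From mathcomp Require Import measurable_realfun ring lra.
Import Order.TTheory GRing.Theory Num.Theory.
Local Open Scope classical_set_scope.
Local Open Scope ring_scope.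

(** * Translations of a single Laplace variable *)

(** The pushforward is a measure that gives every half-open interval its length, and this
    characterizes Lebesgue measure. *)
Lemma lebesgue_measure_translation (R : realType) (s : R) (A : set R) :
  measurable A ->
  pushforward lebesgue_measure (fun x : R => x + s : measurableTypeR R) A =
  lebesgue_measure A.
Proof.
move=> mA.
have ms : measurable_fun [set: measurableTypeR R]
    (fun x : measurableTypeR R => (x : R) + s : measurableTypeR R).
  exact: measurable_funD.
pose mu' : {measure set (measurableTypeR R) -> \bar R} :=
  pushforward lebesgue_measure (fun x : R => x + s : measurableTypeR R).
apply/esym; apply: (@lebesgue_measure_unique R (mu' ms)) => // _ [[a b]] _ <-.
rewrite /mu' /= /pushforward.
have -> : (fun x : R => x + s) @^-1` `]a, b]%classic = `]a - s, b - s]%classic.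
  by apply/seteqP; split => x /=; rewrite !in_itv/= ltrBlDr lerBrDr.
by rewrite !lebesgue_measure_itv/= !lte_fin ltrD2r -!EFinB opprB addrA subrK.
Qed.

Lemma laplace_pdf_ge0 (R : realType) (b x : R) : 0 < b -> 0 <= laplace_pdf b x.
Proof.
by move=> b0; rewrite mulr_ge0 ?expR_ge0 ?invr_ge0 ?mulr_ge0 ?ltW.
Qed.

Lemma measurable_laplace_pdf (R : realType) (b : R) :
  measurable_fun [set: R] (laplace_pdf b).
Proof.
apply: measurable_funM; first exact: measurable_cst.
apply: measurableT_comp; first exact: measurable_expR.
apply: measurable_funN; apply: measurable_funM; last exact: measurable_cst.
exact: normr_measurable.
Qed.

(** After taking logarithms this is the triangle inequality for [x + s]. *)
Lemma laplace_pdf_shift (R : realType) (b s x : R) : 0 < b ->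
  laplace_pdf b x <= expR (`|s| / b) * laplace_pdf b (x + s).
Proof.
move=> b0; rewrite mulrCA ler_pM2l ?invr_gt0 ?mulr_gt0// -expRD ler_expR.
rewrite lerNl opprD opprK addrC -mulrBl ler_pM2r ?invr_gt0// lerBlDr.
exact: ler_normD.
Qed.

Lemma laplace_rv_shift (R : realType) (d : measure_display)
  (Omega : measurableType d) (P : probability Omega R) (X : Omega -> R)
  (b s : R) (A : set R) : 0 < b -> laplace_rv P X b -> measurable A ->
  (P [set w | A (X w + s)%R] <= (expR (`|s| / b))%:E * P [set w | A (X w)])%E.
Proof.
move=> b0 [mX XE] mA.
have ms : measurable_fun [set: measurableTypeR R]
    (fun x : measurableTypeR R => (x : R) + s : measurableTypeR R).
  exact: measurable_funD.
pose As := (fun x : R => x + s) @^-1` A.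
have mAs : measurable As by rewrite -[As]setTI; exact: ms.
have mp D : measurable_fun D (fun x => (laplace_pdf b x)%:E).
  apply/measurable_EFinP; apply: measurable_funS (measurable_laplace_pdf R b) => //.
have mps (D : set R) : measurable_fun D (fun x : R => (laplace_pdf b (x + s))%:E).
  apply: (measurable_funS measurableT) => //; apply/measurable_EFinP.
  by apply: (measurableT_comp (measurable_laplace_pdf R b)).
rewrite (XE As)// (XE A)//.
(* Change of variables: both probabilities become integrals over [As], so the densities can be
   compared pointwise. *)
have -> : (\int[lebesgue_measure]_(x in A) (laplace_pdf b x)%:E =
    \int[lebesgue_measure]_(x in As) (laplace_pdf b (x + s)%R)%:E)%E.
  have h0 : {in A, forall x : R, (0 <= (laplace_pdf b x)%:E)%E}.
    by move=> x _; rewrite lee_fin laplace_pdf_ge0.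
  rewrite -(@ge0_integral_pushforward _ _ _ _ R _ ms lebesgue_measure A
    (fun x => (laplace_pdf b x)%:E) mA (mp _) h0).
  apply: eq_measure_integral => /= B mB _.
  exact/esym/lebesgue_measure_translation.
rewrite -ge0_integralZl_EFin ?expR_ge0//; last 2 first.
- by move=> x _; rewrite lee_fin laplace_pdf_ge0.
- exact: mps.
apply: ge0_le_integral => //.
- by move=> x _; rewrite lee_fin laplace_pdf_ge0.
- exact: mp.
- by apply: measurable_funeM; exact: mps.
- by move=> x _; rewrite -EFinM lee_fin laplace_pdf_shift.
Qed.

(** * Vectors of independent noises and their translations *)

(* Named copy of [K -> R]: the pointed structure is not inferred on the bare
   arrow type. *)
Definition noise_vector (R : realType) (K : Type) : Type := K -> R.

HB.instance Definition _ (R : realType) (K : Type) :=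
  gen_eqMixin (noise_vector R K).
HB.instance Definition _ (R : realType) (K : Type) :=
  gen_choiceMixin (noise_vector R K).
HB.instance Definition _ (R : realType) (K : Type) :=
  isPointed.Build (noise_vector R K) (fun=> 0).

Section cylinders.
Variables (R : realType) (K : finType) (J : {set K}).

Definition box (B : K -> set R) : set (noise_vector R K) :=
  [set w | forall k, k \in J -> B k (w k)].

(* Only the coordinates in [J] are observed: when [eps3 = 0] nothing is assumed
   about the law, or even the measurability, of the noises [eta i]. *)
Definition boxes : set (set (noise_vector R K)) :=
  [set A | exists2 B : K -> set R, (forall k, measurable (B k)) & A = box B].

Local Notation noise_space := (g_sigma_algebraType boxes).

Lemma boxes_setI_closed : setI_closed boxes.
Proof.
move=> _ _ [B mB ->] [C mC ->]; exists (fun k => B k `&` C k).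
  by move=> k; exact: measurableI.
apply/seteqP; split => [w [Bw Cw] k kJ|w BC]; first by split; [exact: Bw|exact: Cw].
by split=> k /BC[].
Qed.

Lemma boxes_setT : boxes setT.
Proof. by exists (fun=> setT) => //; apply/seteqP; split. Qed.

Lemma measurable_coord (k : K) : k \in J ->
  measurable_fun [set: noise_space] (fun w : noise_space => w k).
Proof.
move=> kJ _ B mB; rewrite setTI; apply: sub_sigma_algebra.
exists (fun j => if j == k then B else setT); first by move=> j; case: ifP.
apply/seteqP; split=> [w Bw j _|w /(_ _ kJ)]; last by rewrite eqxx.
by case: eqP => // ->.
Qed.

Lemma measurable_fun_noise d (T : measurableType d) (f : T -> noise_space) :
  (forall k, k \in J -> measurable_fun [set: T] (fun t => f t k)) ->
  measurable_fun [set: T] f.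
Proof.
move=> mf; apply: (@measurability _ _ T noise_space setT f boxes) => // _ [_ [B mB ->] <-].
rewrite setTI.
rewrite (_ : _ @^-1` _ =
    \bigcap_(k in [set k | k \in J]) ((fun t => f t k) @^-1` B k)) //.
apply: fin_bigcap_measurable => // k kJ.
by rewrite -[X in measurable X]setTI; exact: mf.
Qed.

Definition upd (w : K -> R) (k : K) (x : R) : K -> R :=
  fun j => if j == k then x else w j.

Definition shift1 (w : K -> R) (k : K) (s : R) : K -> R := upd w k (w k + s).

Lemma measurable_shift1 (k : K) (s : R) : k \in J ->
  measurable_fun [set: noise_space]
    (fun w : noise_space => shift1 w k s : noise_space).
Proof.
move=> kJ; apply: measurable_fun_noise => j jJ; rewrite /shift1 /upd.
case: eqP => _; last exact: measurable_coord.
apply: measurable_funD; last exact: measurable_cst.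
exact: measurable_coord.
Qed.

Variables (d : measure_display) (Omega : measurableType d).
Variables (P : probability Omega R) (X : K -> Omega -> R).
Hypothesis X_indep : mutually_independent P X.
Hypothesis mX : forall k, k \in J -> measurable_fun [set: Omega] (X k).

Definition sample (w : Omega) : noise_space := fun k => X k w.

Lemma measurable_sample : measurable_fun [set: Omega] sample.
Proof. exact: measurable_fun_noise. Qed.

Lemma measurable_resample (k : K) : measurable_fun [set: Omega * R]
  (fun z : Omega * R => upd (sample z.1) k z.2 : noise_space).
Proof.
apply: measurable_fun_noise => j jJ; rewrite /upd.
case: eqP => _; first exact: measurable_snd.
by apply: (measurableT_comp (mX _ jJ)); exact: measurable_fst.
Qed.

(* Independence makes the [k]-th noise replaceable by a fresh copy of itself;
   both laws agree on boxes. *)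
Lemma sample_resample (k : K) (A : set noise_space) : k \in J -> measurable A ->
  P (sample @^-1` A) =
  (\int[P]_w P [set w' | A (upd (sample w) k (X k w'))])%E.
Proof.
move=> kJ mA.
pose Xk : {mfun Omega >-> R} :=
  HB.pack (X k) (isMeasurableFun.Build _ _ _ _ _ (mX _ kJ)).
pose L := distribution P Xk.
pose U (z : Omega * R) : noise_space := upd (sample z.1) k z.2.
have mU : measurable_fun [set: Omega * R] U by exact: measurable_resample.
pose m1 := pushforward P sample : {measure set noise_space -> \bar R}.
pose m2 := pushforward (P \x L)%E U : {measure set noise_space -> \bar R}.
(* [m2] is the law of the vector whose coordinate [k] is drawn independently of all the others;
   integrating its sections gives the right-hand side. *)
transitivity (m2 mU A); last first.
  rewrite /m2 /= /pushforward /product_measure1; apply: eq_integral => w _ /=.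
  by rewrite /L /distribution /pushforward xsectionE.
rewrite -[LHS]/(m1 measurable_sample A).
(* Boxes are stable under intersection and generate the sigma-algebra, so agreement on boxes
   suffices. *)
apply: (@measure_unique _ R noise_space boxes (fun=> setT) _ _ _ _
  (m1 measurable_sample) (m2 mU)) => //.
- exact: boxes_setI_closed.
- by move=> _; exact: boxes_setT.
- by apply/seteqP; split => // w _; exists 0%N.
- move=> _ [B mB ->]; rewrite /m1 /m2 /= /pushforward.
  have -> : U @^-1` box B =
      (\bigcap_(j in [set j | j \in J :\ k]) (X j @^-1` B j)) `*` B k.
    apply/seteqP; split => [[w x] /= UB|[w x] /= [XB Bx] j jJ].
      split => [j /setD1P[jk jJ]|].
        by move: (UB _ jJ); rewrite /U /upd /= (negPf jk).
      by move: (UB _ kJ); rewrite /U /upd /= eqxx.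
    rewrite /U /upd /=; case: eqP => [->//|/eqP jk].
    by apply: XB; rewrite /= !inE jk.
  have -> : sample @^-1` box B =
      \bigcap_(j in [set j | j \in J]) (X j @^-1` B j) by [].
  rewrite product_measure1E//; last first.
    apply: fin_bigcap_measurable => // j /setD1P[_ jJ].
    by rewrite -[X in measurable X]setTI; exact: mX.
  (* Independence is used twice: over [J] for the left-hand side, over [J :\ k] for the first factor
     of the product measure. *)
  rewrite (X_indep J B mB) (big_setD1 k)//= muleC; congr (_ * _)%E.
  exact/esym/(X_indep (J :\ k) B mB).
- by move=> _; rewrite /m1 /= /pushforward preimage_setT probability_setT ltry.
Qed.

Variable b : K -> R.
Hypothesis b_gt0 : forall k, k \in J -> 0 < b k.
Hypothesis X_laplace : forall k, k \in J -> laplace_rv P (X k) (b k).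

(** Once coordinate [k] is resampled, the other coordinates are frozen under the integral, where
    only one Laplace variable moves; the bound for that variable is then integrated. *)
Lemma sample_shift1 (k : K) (s : R) (A : set noise_space) :
  k \in J -> measurable A ->
  (P [set w | A (shift1 (sample w) k s)] <=
   (expR (`|s| / b k))%:E * P (sample @^-1` A))%E.
Proof.
move=> kJ mA.
have mA' : measurable [set w : noise_space | A (shift1 w k s)].
  by rewrite -[X in measurable X]setTI; exact: measurable_shift1.
have mres (B : set noise_space) : measurable B -> measurable_fun [set: Omega]
    (fun w => P [set w' | B (upd (sample w) k (X k w'))]).
  move=> mB.
  pose Xk : {mfun Omega >-> R} :=
    HB.pack (X k) (isMeasurableFun.Build _ _ _ _ _ (mX _ kJ)).
  have mUB : measurable [set z : Omega * R | B (upd (sample z.1) k z.2)].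
    by rewrite -[X in measurable X]setTI; exact: measurable_resample.
  have := measurable_fun_xsection (distribution P Xk) mUB.
  apply: eq_measurable_fun => w _ /=.
  by rewrite /distribution /pushforward xsectionE.
rewrite (sample_resample _ _ kJ mA') (sample_resample _ _ kJ mA).
rewrite -ge0_integralZl_EFin ?expR_ge0//; last exact: mres.
apply: ge0_le_integral => //.
- exact: mres.
- by apply: measurable_funeM; exact: mres.
move=> w _.
have mAw : measurable [set x : R | A (upd (sample w) k x)].
  have := measurable_resample k measurableT _ mA; rewrite setTI.
  by move=> /measurable_xsection => /(_ w); rewrite xsectionE.
have := laplace_rv_shift R d Omega P (X k) (b k) s _ (b_gt0 _ kJ)
  (X_laplace _ kJ) mAw.
apply: le_trans; rewrite le_eqVlt; apply/orP; left; apply/eqP; congr (P _).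
apply/funext => w' /=; congr (A _); apply/funext => j.
by rewrite /shift1 /upd eqxx; case: (j == k).
Qed.

(** Coordinates are moved one at a time, each contributing its own factor. The induction ranges over
    all events [A], since the head shift is absorbed into the event. *)
Lemma sample_shift_seq (s : K -> R) (r : seq K) (A : set noise_space) :
  all [in J] r -> measurable A ->
  (P [set w | A (foldr (fun k v => shift1 v k (s k)) (sample w) r)] <=
   (expR (\sum_(k <- r) `|s k| / b k))%:E * P (sample @^-1` A))%E.
Proof.
elim: r A => [|k r IH] A /=; first by rewrite big_nil expR0 mul1e.
move=> /andP[kJ rJ] mA.
have mA' : measurable [set v : noise_space | A (shift1 v k (s k))].
  by rewrite -[X in measurable X]setTI; exact: measurable_shift1.
apply: (le_trans (IH _ rJ mA')); rewrite big_cons addrC expRD EFinM -muleA.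
by rewrite lee_pmul2l ?lte_fin ?expR_gt0//; exact: sample_shift1.
Qed.

Lemma sample_shift (s : K -> R) (A : set noise_space) :
  (forall k, k \notin J -> s k = 0) -> measurable A ->
  (P [set w | A (fun k => (X k w + s k)%R)] <=
   (expR (\sum_(k in J) `|s k| / b k))%:E * P (sample @^-1` A))%E.
Proof.
move=> sJ mA; have enumJ : all [in J] (enum J) by apply/allP => k; rewrite mem_enum.
have := sample_shift_seq s _ _ enumJ mA; rewrite big_enum.
(* The enumeration of [J] has no repetition, so each coordinate in [J] moves exactly once; the
   others have zero shift. *)
suff shiftE r w j : uniq r -> foldr (fun k v => shift1 v k (s k)) w r j =
    w j + (if j \in r then s j else 0).
  congr ((P _ <= _)%E); apply/funext => w /=; congr (A _); apply/funext => j.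
  rewrite shiftE ?enum_uniq// mem_enum /sample.
  by case: (boolP (j \in J)) => // /sJ ->.
elim: r => [|k r IH] /=; first by rewrite addr0.
move=> /andP[kr ur]; rewrite /shift1 /upd in_cons; have [jk|jk] /= := eqVneq j k.
  by rewrite -jk IH// jk (negPf kr) addr0.
exact: IH.
Qed.

End cylinders.

(** * The loop: number of positive answers, shifted noise, measurability *)

Section loop.
Variables (R : realType) (c : nat) (eps3 : R).
Implicit Types (rho : R) (xs : seq (R * R * R * R)) (a : nat * R).

Definition answered a := (a.1 == 1%N) || (a.1 == 2%N).

Lemma size_svt_loop rho cnt xs : size (svt_loop c eps3 rho cnt xs) = size xs.
Proof.
elim: xs cnt => [//|[[[qv t] nu] eta] xs IH] cnt /=.
by case: ifP => _; [|case: ifP => _]; rewrite /= IH.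
Qed.

Lemma count_answered_svt_loop rho cnt xs :
  (count answered (svt_loop c eps3 rho cnt xs) <= c - cnt)%N.
Proof.
elim: xs cnt => [//|[[[qv t] nu] eta] xs IH] cnt /=.
case: (leqP c cnt) => [_|cntc] /=; rewrite ?{1}/answered/=; first exact: IH.
case: ifP => _; last exact: IH.
by case: (0 < eps3); rewrite /answered /= add1n -(subnSK cntc) ltnS.
Qed.

Variables (I : eqType) (q q' t nu eta nu' eta' : I -> R) (A : pred I).

(** Each test has the same result in both runs, so their counters stay equal and the induction goes
    through for any [cnt]. The hypothesis on [map answered out] tells, at each query, which shift
    its noise received. *)
Lemma svt_loop_shift (rho r : R) (l : seq I) cnt :
  (forall i, 0 <= r + q i - q' i) ->
  (forall i, nu' i = nu i + (if A i then r + q i - q' i else 0)) ->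
  (forall i, 0 < eps3 -> A i -> eta' i = eta i + (q i - q' i)) ->
  let out := svt_loop c eps3 rho cnt [seq (q i, t i, nu i, eta i) | i <- l] in
  map answered out = map A l ->
  svt_loop c eps3 (rho + r) cnt [seq (q' i, t i, nu' i, eta' i) | i <- l] = out.
Proof.
move=> r_ge nu'E eta'E; elim: l cnt => [//|i l IH] cnt /=.
case: ifP => _ /=; first by move=> [_ /IH ->].
case: (leP (t i + rho) (q i + nu i)) => [above|below] /=.
  rewrite (_ : answered _ = true); last by case: ifP.
  move=> [Ai /IH ->]; rewrite nu'E -Ai.
  (* Both sides of a positive test gain exactly [r]. *)
  rewrite (_ : q' i + _ = q i + nu i + r); last by ring.
  rewrite addrA lerD2r above; congr (_ :: _); case: ifP => // eps3_gt0.
  by rewrite eta'E// addrCA subrKC addrC.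
rewrite {1}/answered /= => -[Ai /IH ->]; rewrite nu'E -Ai addr0.
(* In a negative test the threshold side gains [r], while the query side gains [q' i - q i], which
   is at most [r]. *)
rewrite leNgt (_ : q' i + nu i < _)//.
by have := r_ge i; lra.
Qed.

End loop.

Lemma measurable_svt_loop (R : realType) (d : measure_display)
  (T : measurableType d) (I : Type) (c : nat) (eps3 : R) (q t : I -> R)
  (rho : T -> R) (nu eta : I -> T -> R) (l : seq I) (cnt j : nat) :
  measurable_fun [set: T] rho -> (forall i, measurable_fun [set: T] (nu i)) ->
  (0 < eps3 -> forall i, measurable_fun [set: T] (eta i)) ->
  measurable_fun [set: T] (fun w => nth (3%N, 0) (svt_loop c eps3 (rho w) cnt
    [seq (q i, t i, nu i w, eta i w) | i <- l]) j : nat * R).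
Proof.
move=> mrho mnu meta; elim: l cnt j => [|i l IH] cnt j /=.
  by rewrite nth_nil; exact: measurable_cst.
case: (c <= cnt)%N; first by case: j => [|j] /=; [exact: measurable_cst|exact: IH].
(* With the test moved outside [nth], each branch is a measurable function for a fixed index [j]. *)
under eq_fun do rewrite (fun_if (fun x => nth (3%N, 0) x j)).
apply: measurable_fun_ifT.
- by apply: measurable_fun_ler; apply: measurable_funD => //; exact: measurable_cst.
- case: j => [|j] /=; last exact: IH.
  have [eps3_gt0|_] := boolP (0 < eps3); last exact: measurable_cst.
  apply: measurable_fun_pair; first exact: measurable_cst.
  by apply: measurable_funD; [exact: measurable_cst|exact: meta].
- by case: j => [|j] /=; [exact: measurable_cst|exact: IH].
Qed.

(** * Output tuples and their sets of positive answers *)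

Definition answered_set (R : realType) (n : nat) (a : n.-tuple (nat * R)) :
  {set 'I_n} := [set i | answered R (tnth a i)].

Section svt_out_properties.
Variables (R : realType) (Dat : Type) (n : nat) (q : 'I_n -> Dat -> R).
Variables (T : 'I_n -> R) (c : nat) (eps3 : R).

(** Queries after the abort still emit an entry, so the loop returns exactly [n] entries and the
    default of [nth] never shows. *)
Lemma svt_outE (D : Dat) rho nu eta :
  svt_out q T c eps3 D rho nu eta = svt_loop c eps3 rho 0
    [seq (q i D, T i, nu i, eta i) | i <- enum 'I_n] :> seq (nat * R).
Proof.
apply: (@eq_from_nth _ (3%N, 0)) => [|i].
  by rewrite size_tuple size_svt_loop size_map size_enum_ord.
rewrite size_tuple => lt_in.
by rewrite -(tnth_nth _ _ (Ordinal lt_in)) tnth_mktuple.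
Qed.

Lemma card_answered_svt_out (D : Dat) rho nu eta :
  (#|answered_set R n (svt_out q T c eps3 D rho nu eta)| <= c)%N.
Proof.
set a := svt_out _ _ _ _ _ _ _ _.
rewrite (_ : #|_| = count (answered R) a).
  by rewrite svt_outE -[leqRHS]subn0 count_answered_svt_loop.
rewrite -[in RHS](map_tnth_enum a) count_map cardsE cardE -size_filter enumT.
by [].
Qed.

Lemma svt_out_shift (D D' : Dat) (rho r : R) (nu eta nu' eta' : 'I_n -> R)
  (A : {set 'I_n}) :
  (forall i, 0 <= r + q i D - q i D') ->
  (forall i, nu' i = nu i + (if i \in A then r + q i D - q i D' else 0)) ->
  (forall i, 0 < eps3 -> i \in A -> eta' i = eta i + (q i D - q i D')) ->
  answered_set R n (svt_out q T c eps3 D rho nu eta) = A ->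
  svt_out q T c eps3 D' (rho + r) nu' eta' = svt_out q T c eps3 D rho nu eta.
Proof.
move=> r_ge nu'E eta'E patA; apply: val_inj => /=.
rewrite -[LHS]/(tval (svt_out q T c eps3 D' (rho + r) nu' eta')).
rewrite -[RHS]/(tval (svt_out q T c eps3 D rho nu eta)) !svt_outE.
apply: (svt_loop_shift R c eps3 _ (q^~ D) (q^~ D') T nu eta nu' eta' [in A]) => //.
rewrite -svt_outE -patA -[in LHS](map_tnth_enum (svt_out _ _ _ _ _ _ _ _)).
by rewrite -map_comp; apply: eq_map => i; rewrite /= inE.
Qed.

Lemma measurable_svt_out d (Omega : measurableType d) (D : Dat)
  (rho : Omega -> R) (nu eta : 'I_n -> Omega -> R) :
  measurable_fun [set: Omega] rho ->
  (forall i, measurable_fun [set: Omega] (nu i)) ->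
  (0 < eps3 -> forall i, measurable_fun [set: Omega] (eta i)) ->
  measurable_fun [set: Omega]
    (fun w => svt_out q T c eps3 D (rho w) (nu ^~ w) (eta ^~ w)).
Proof.
move=> mrho mnu meta; apply/measurable_fun_tnthP => i.
have := measurable_svt_loop _ _ _ _ c eps3 (q^~ D) T _ _ _ (enum 'I_n) 0 i
  mrho mnu meta.
by apply: eq_measurable_fun => w _ /=; rewrite -svt_outE -tnth_nth.
Qed.

End svt_out_properties.

Lemma measurable_answered_set (R : realType) (n : nat) (A : {set 'I_n}) :
  measurable [set a : n.-tuple (nat * R) | answered_set R n a = A].
Proof.
rewrite (_ : mkset _ = \bigcap_(i in [set: 'I_n])
    ((fun a : n.-tuple (nat * R) => tnth a i) @^-1`
      [set x | answered R x = (i \in A)])); last first.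
  apply/seteqP; split => [a /= <- i _|a /= aA]; first by rewrite /= inE.
  by apply/setP => i; rewrite inE; exact: aA.
apply: fin_bigcap_measurable => // i _.
rewrite -[X in measurable X]setTI; apply: measurable_tnth => //.
rewrite (_ : mkset _ = fst @^-1`
  [set k : nat | ((k == 1%N) || (k == 2%N)) = (i \in A)]) //.
by rewrite -[X in measurable X]setTI; exact: measurable_fst.
Qed.

(** * Cost of the translation, and the privacy bound *)

(* The junk value [_ / 0 = 0] makes the case [eps = 0] harmless. *)
Lemma shift_cost_le (R : realType) (n c : nat) (A : {set 'I_n})
  (Delta eps : R) (x : 'I_n -> R) :
  (0 < c)%N -> 0 < Delta -> 0 <= eps -> (#|A| <= c)%N ->
  (forall i, i \in A -> `|x i| <= Delta) -> (forall i, i \notin A -> x i = 0) ->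
  \sum_i `|x i| / (c%:R * Delta / eps) <= eps.
Proof.
move=> c_gt0 Delta_gt0 eps_ge0 cardA xA xNA.
have c_pos : 0 < c%:R :> R by rewrite ltr0n.
(* Each index in [A] costs at most [Delta / (c * Delta / eps) = eps / c], and there are at most [c]
   of them. *)
apply: (@le_trans _ _ (\sum_(i in A) eps / c%:R)).
  rewrite [leRHS]big_mkcond; apply: ler_sum => i _; rewrite invf_div.
  case: (boolP (i \in A)) => [/xA xi|/xNA ->]; last by rewrite normr0 mul0r.
  rewrite [leRHS](_ : _ = Delta * (eps / (c%:R * Delta))); last first.
    by field; rewrite !gt_eqF.
  by rewrite ler_wpM2r// divr_ge0// mulr_ge0 ?ltW.
rewrite sumr_const -[_ *+ #|A|]mulr_natr mulrAC ler_pdivrMr// ler_wpM2l// ler_nat.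
exact: cardA.
Qed.

Theorem theorem4 (R : realType) (Dat : Type) (nbr : Dat -> Dat -> Prop)
  (n : nat) (q : 'I_n -> Dat -> R) (T : 'I_n -> R) (c : nat)
  (eps1 eps2 eps3 Delta : R)
  (d : measure_display) (Omega : measurableType d) (P : probability Omega R)
  (rho : Omega -> R) (nu eta : 'I_n -> Omega -> R) :
  0 < eps1 -> 0 < eps2 -> 0 <= eps3 -> 0 < Delta -> (1 <= c)%N ->
  sensitivity_le nbr q Delta ->
  monotonic_queries nbr q ->
  laplace_rv P rho (Delta / eps1) ->
  (forall i, laplace_rv P (nu i) (c%:R * Delta / eps2)) ->
  (0 < eps3 -> forall i, laplace_rv P (eta i) (c%:R * Delta / eps3)) ->
  mutually_independent P (svt_noise rho nu eta) ->
  forall (D D' : Dat), nbr D D' ->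
  forall S : set (n.-tuple (nat * R)), measurable S ->
    (P ((fun w => svt_out q T c eps3 D (rho w) (nu ^~ w) (eta ^~ w)) @^-1` S)
     <= (expR (eps1 + eps2 + eps3))%:E *
        P ((fun w => svt_out q T c eps3 D' (rho w) (nu ^~ w) (eta ^~ w)) @^-1` S))%E.
Proof.
move=> eps1_gt0 eps2_gt0 eps3_ge0 Delta_gt0 c_gt0 sens mono rhoL nuL etaL indep.
move=> D D' DD' S mS.
have c_pos : 0 < c%:R :> R by rewrite ltr0n.
have [r /andP[r_ge0 r_le] rP] : exists2 r, 0 <= r <= Delta &
    forall i, 0 <= r + q i D - q i D' <= Delta.
  have [geq|leq] := mono _ _ DD'; [exists 0|exists Delta];
    rewrite ?lexx ?(ltW Delta_gt0)//= => i.
  - by have := sens i _ _ DD'; rewrite ler_norml; have := geq i; lra.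
  - by have := sens i _ _ DD'; rewrite ler_norml; have := leq i; lra.
pose K : finType := option ('I_n + 'I_n).
(* [J] collects the noises whose law is known: all of them if [0 < eps3], otherwise [rho] and the
   [nu i]. *)
pose J : {set K} :=
  [set k : K | if k is Some (inr _) then 0 < eps3 else true]%SET.
pose b (k : K) := match k with
  | None => Delta / eps1
  | Some (inl _) => c%:R * Delta / eps2
  | Some (inr _) => c%:R * Delta / eps3 end.
pose X := svt_noise rho nu eta.
have XL (k : K) : k \in J -> laplace_rv P (X k) (b k).
  by rewrite inE; case: k => [[i|i]|] //= eps3_gt0; exact: etaL.
have mX (k : K) : k \in J -> measurable_fun [set: Omega] (X k).
  by move=> /XL[].
have b_gt0 (k : K) : k \in J -> 0 < b k.
  by rewrite inE; case: k => [[i|i]|] /= *; rewrite !divr_gt0 ?mulr_gt0.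
pose F D0 (w : g_sigma_algebraType (boxes R K J)) :=
  svt_out q T c eps3 D0 (w None)
    (fun i => w (Some (inl i))) (fun i => w (Some (inr i))).
have mF D0 : measurable_fun setT (F D0).
  have mcoord (k : K) (kJ : k \in J) := measurable_coord R K J k kJ.
  refine (measurable_svt_out R Dat n q T c eps3 _
    (g_sigma_algebraType (boxes R K J)) D0 (fun w => w None)
    (fun i w => w (Some (inl i))) (fun i w => w (Some (inr i))) _ _ _).
  - by apply: (mcoord None); rewrite inE.
  - by move=> i; apply: (mcoord (Some (inl i))); rewrite inE.
  - by move=> eps3_gt0 i; apply: (mcoord (Some (inr i))); rewrite inE.
pose cls A := S `&` [set a | answered_set R n a = A].
have mcls A : measurable (cls A).
  by apply: measurableI => //; exact: measurable_answered_set.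
pose E D0 A := sample R K J d Omega X @^-1` (F D0 @^-1` cls A).
have mFcls D0 A : measurable (F D0 @^-1` cls A).
  by rewrite -[X in measurable X]setTI; exact: mF.
have mE D0 A : measurable (E D0 A).
  by rewrite -[X in measurable X]setTI; exact: measurable_sample.
have decomp D0 :
    P ((fun w => svt_out q T c eps3 D0 (rho w) (nu ^~ w) (eta ^~ w)) @^-1` S) =
    (\sum_(A \in [set: {set 'I_n}]) P (E D0 A))%E.
  rewrite (_ : _ @^-1` S = \bigcup_(A in [set: {set 'I_n}]) E D0 A); last first.
    apply/seteqP; split => [w Sw|w [A _ []]//].
    by exists (answered_set R n (F D0 (sample R K J d Omega X w))).
  apply: measure_fin_bigcup => //; first exact: finite_finset.
  apply/trivIsetP => A B _ _ /eqP AB; apply/seteqP; split => // w.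
  by move=> [[_ wA] [_ wB]]; apply: AB; rewrite -wA -wB.
rewrite !decomp ge0_mule_fsumr; last by move=> A; exact: measure_ge0.
apply: lee_fsum => [|A _]; first exact: finite_finset.
(* A pattern with more than [c] positive answers never occurs, because of the cutoff. *)
have [cardA|cardA] := ltnP c #|A|.
  rewrite (_ : E D A = set0) ?measure0 ?mule_ge0 ?lee_fin ?expR_ge0//.
  apply/seteqP; split => // w /= [_ /= AE]; move: cardA; rewrite ltnNge -AE.
  by rewrite card_answered_svt_out.
pose s (k : K) := match k with
  | None => r
  | Some (inl i) => if i \in A then r + q i D - q i D' else 0
  (* The guard [0 < eps3] makes [s] vanish outside [J]. *)
  | Some (inr i) => if (0 < eps3) && (i \in A) then q i D - q i D' else 0 end.
have sJ (k : K) : k \notin J -> s k = 0.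
  by rewrite inE; case: k => [[i|i]|] //= /negPf ->.
have mshift : measurable
    [set w | (F D' @^-1` cls A) (fun k => X k w + s k)].
  rewrite -[X in measurable X]setTI.
  apply: (measurable_fun_noise R K J d Omega
    (fun w (k : K) => X k w + s k)) => // k kJ.
  by apply: measurable_funD; [exact: mX|exact: measurable_cst].
apply: (@le_trans _ _
  (P [set w | (F D' @^-1` cls A) (fun k => (X k w + s k)%R)])).
  apply: le_measure; rewrite ?inE// => w [Sw /= patA].
  (* The two outputs are equal, so membership in [S] and the pattern [A] carry over together. *)
  rewrite /= (_ : F D' _ = F D (sample R K J d Omega X w)) //.
  apply: (svt_out_shift _ _ _ _ _ _ _ _ _ _ _ _ _ _ _ A _ _ _ patA) => // i.
  - by have /andP[] := rP i.
  - by move=> eps3_gt0 iA; rewrite /s /= eps3_gt0 iA.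
apply: (le_trans (sample_shift R K J d Omega P X indep mX b b_gt0 XL s _ sJ
  (mFcls D' A))).
apply: lee_wpmul2r => //; rewrite lee_fin ler_expR.
(* Summing over all of [K] only adds nonnegative terms and lets the sum split into its [rho], [nu]
   and [eta] parts. *)
apply: (@le_trans _ _ (\sum_(k : K) `|s k| / b k)).
  rewrite [leRHS](bigID [in J])/= lerDl sumr_ge0// => k _; rewrite mulr_ge0//.
  have [[De e1] e2] := (ltW Delta_gt0, ltW eps1_gt0, ltW eps2_gt0).
  by rewrite invr_ge0; case: k => [[i|i]|] /=; rewrite divr_ge0 ?mulr_ge0.
rewrite (bigD1 None)//= (reindex_omap Some id)//=; last by case.
rewrite big_sumType/= -addrA lerD//.
  (* The [rho] part is [r / (Delta / eps1)], at most [eps1] since [r <= Delta]. *)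
  by rewrite ger0_norm// invf_div mulrA ler_pdivrMr// mulrC ler_pM2l.
apply: lerD; (rewrite (eq_bigl predT); last by move=> i; rewrite /= eqxx);
  apply: (shift_cost_le _ _ _ A) => //.
- exact: ltW.
- by move=> i ->; have /andP[? ?] := rP i; rewrite ger0_norm.
- by move=> i /negPf ->.
- by move=> i ->; case: ifP => _; rewrite ?normr0 ?(ltW Delta_gt0)// sens.
- by move=> i /negPf ->; rewrite andbF.
Qed.
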